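(* For integers $j\ge 0$ and $n\ge j$ let $p_j(n)=d_{2n-j,\,j}$, i.e. $d_{i,j}=p_j(n)$ with $n=(i+j)/2$. Then $p_0(n)=c_n$ for $n\ge 0$, $p_1(n)=c_n$ for $n\ge 1$, and for all $j>1$ and $n\ge j$, $$p_j(n)=p_{j-1}(n)-p_{j-2}(n-1).$$
   Context: Here $c_n=\frac{(2n)!}{n!(n+1)!}$ is the $n$-th Catalan number ($c_0=1$). The label $d_{i,j}$ of an integer point $(i,j)$ with $i,j\ge 0$ is the number of lattice paths from $(0,0)$ to $(i,j)$ composed of up-steps $(1,1)$ and down-steps $(1,-1)$ that never go below the $x$-axis. The $p_j$ are called Dyck polynomials (they are linear combinations of the Catalan numbers $c_n,c_{n-1},\dots$ with coefficients depending only on $j$). *)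

(* Defs.v *)
From mathcomp Require Import all_boot all_order all_algebra.

Set Implicit Arguments.
Unset Strict Implicit.
Unset Printing Implicit Defensive.

Import Order.TTheory GRing.Theory Num.Theory.
Local Open Scope ring_scope.

(* The division takes place in rat, so it is exact. *)
Definition catalan (n : nat) : rat :=
  (2 * n)%N`!%:R / (n`!%:R * n.+1`!%:R).

(* A path is its sequence of steps: true is the up-step (1,1) and false is the
   down-step (1,-1). *)
Definition step (b : bool) : int := if b then 1 else -1.

Definition height (s : seq bool) : int := \sum_(b <- s) step b.

(* The prefixes of s, including the empty one and s itself, end at the
   successive points of the path. *)
Definition above_axis (s : seq bool) : bool :=
  all (fun k => 0 <= height (take k s)) (iota 0 (size s).+1).

(* Every step increases the abscissa by one, so the paths from (0,0) to (i,j)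
   have exactly i steps. *)
Definition dyck_label (i j : nat) : nat :=
  #|[set s : i.-tuple bool | above_axis s && (height s == j%:Z)]|.

(* Only meaningful for j <= n, where 2 * n - j is not truncated. *)
Definition dyck_poly (j n : nat) : nat := dyck_label (2 * n - j)%N j.

(* Main.v *)
Require Import Defs.
From mathcomp Require Import all_boot all_order all_algebra.
From mathcomp Require Import zify ring.

Import Order.TTheory GRing.Theory Num.Theory.
Local Open Scope ring_scope.

(** Splitting off the last step of a path gives the triangle recurrence
    d(i+1, 0) = d(i, 1) and d(i+1, j+1) = d(i, j) + d(i, j+2).  Along the
    diagonal coordinates (i, j) = (2n - j, j) the second equation is the
    three-term relation p_(j+1)(n) = p_j(n-1) + p_(j+2)(n), and the first says
    that p_1 and p_0 agree on n >= 1.  It remains to evaluate p_0(n) = d(2n, 0).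
    The recurrence determines the whole triangle, and it is satisfied by the
    ballot numbers
      d(j + 2k, j) = (j + 1) (j + 2k)! / (k! (j + k + 1)!),
    which for j = 0 are the Catalan numbers; see [dyck_labelS0],
    [dyck_labelSS] and [dyck_label_ballot]. *)

(** * Splitting off the last step *)

Lemma card_tuple_rcons (T : finType) (n : nat) (P : pred (seq T)) :
  #|[set s : n.+1.-tuple T | P s]| =
  (\sum_(x : T) #|[set s : n.-tuple T | P (rcons s x)]|)%N.
Proof.
pose f (p : T * n.-tuple T) : n.+1.-tuple T := [tuple of rcons p.2 p.1].
have f_inj : injective f.
  move=> [x s] [y t] /(congr1 val) /= /rcons_inj [st ->].
  by congr (_, _); apply: val_inj.
have f_bij : bijective f.
  by apply: (inj_card_bij f_inj); rewrite card_prod !card_tuple expnS.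
rewrite cardsE -sum1_card (reindex f) /=; last exact: onW_bij.
under [RHS]eq_bigr => x _ do rewrite cardsE -sum1_card.
by rewrite (pair_big_dep xpredT (fun x (s : n.-tuple T) => P (rcons s x))).
Qed.

Lemma height_rcons (s : seq bool) (b : bool) :
  height (rcons s b) = height s + step b.
Proof. by rewrite /height -cats1 big_cat big_seq1. Qed.

Lemma above_axis_rcons (s : seq bool) (b : bool) :
  above_axis (rcons s b) = above_axis s && (0 <= height (rcons s b)).
Proof.
rewrite /above_axis size_rcons -[(size s).+2]addn1 iotaD all_cat add0n /= andbT.
rewrite -[in take (size s).+1 _](size_rcons s b) take_size; congr (_ && _).
rewrite !take0; congr (_ && _).
apply: eq_in_all => k; rewrite mem_iota add1n ltnS => /andP[_ k_le].
by rewrite -cats1 takel_cat.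
Qed.

Lemma above_axis_height_ge0 (s : seq bool) : above_axis s -> 0 <= height s.
Proof.
by move/allP/(_ (size s)); rewrite mem_iota leqnn take_size; apply.
Qed.

(** As the final ordinate j is nonnegative, the last step cannot be the one
    that leads below the axis: only the condition on s survives. *)
Lemma dyck_path_rcons (s : seq bool) (b : bool) (j : nat) :
  above_axis (rcons s b) && (height (rcons s b) == j%:Z) =
  above_axis s && (height s == j%:Z - step b).
Proof.
rewrite above_axis_rcons height_rcons -andbA; congr (_ && _).
rewrite eq_sym -subr_eq [RHS]eq_sym.
by case: eqP => [<-|]; rewrite ?andbF // subrK.
Qed.

(** The two terms count the paths ending with an up-step and with a
    down-step; the first is kept as a set because j - 1 may be negative. *)
Lemma dyck_label_last_step (i j : nat) :
  dyck_label i.+1 j =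
  (#|[set s : i.-tuple bool | above_axis s && (height s == j%:Z - 1)%R]|
   + dyck_label i j.+1)%N.
Proof.
rewrite /dyck_label.
rewrite (@card_tuple_rcons _ i (fun s => above_axis s && (height s == j%:Z))).
rewrite big_bool; congr (_ + _)%N; apply: eq_card => s;
  rewrite !inE dyck_path_rcons //=.
by rewrite opprK -[j.+1]addn1 PoszD.
Qed.

Lemma dyck_labelS0 (i : nat) : dyck_label i.+1 0 = dyck_label i 1.
Proof.
rewrite dyck_label_last_step; set A := [set _ | _].
suff -> : A = set0 by rewrite cards0.
apply/setP => s; rewrite !inE; apply/negP => /andP[/above_axis_height_ge0].
by move=> h_ge0 /eqP h_eq; rewrite h_eq in h_ge0.
Qed.

Lemma dyck_labelSS (i j : nat) :
  dyck_label i.+1 j.+1 = (dyck_label i j + dyck_label i j.+2)%N.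
Proof. by rewrite dyck_label_last_step -[j.+1%:Z]/(1 + j)%N%:Z PoszD addrC addKr. Qed.

(** * The ballot numbers *)

Lemma dyck_label0 (j : nat) : dyck_label 0 j = (j == 0)%N.
Proof.
rewrite /dyck_label; case: j => [|j] /=.
  rewrite (_ : [set _ | _] = setT) ?cardsT ?card_tuple //.
  by apply/setP => s; rewrite !inE tuple0 /above_axis /= /height !big_nil.
rewrite (_ : [set _ | _] = set0) ?cards0 //.
by apply/setP => s; rewrite !inE tuple0 /height big_nil andbF.
Qed.

Lemma dyck_label_gt (i j : nat) : (i < j)%N -> dyck_label i j = 0%N.
Proof.
elim: i j => [|i IHi] [|j] // ij; first by rewrite dyck_label0.
by rewrite dyck_labelSS !IHi // ltnW // ltnW.
Qed.

(** The induction is on the number i of steps, so that both entries on the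
    right of the recurrence are covered by one hypothesis.  The recurrence
    preserves the parity of i - j, and leaves the range j <= i of the formula
    only from the edge i = j, where [dyck_label_gt] supplies the missing
    entry. *)
Lemma dyck_label_ballot (k j : nat) :
  (dyck_label (j + 2 * k) j)%:R =
  (j.+1%:R * (j + 2 * k)`!%:R) / (k`!%:R * (j + k).+1`!%:R) :> rat.
Proof.
have [i ijk] : {i : nat | i = (j + 2 * k)%N} by exists (j + 2 * k)%N.
have fN0 n : n`!%:R != 0 :> rat by rewrite pnatr_eq0 -lt0n fact_gt0.
have sN0 n : 1 + n%:R != 0 :> rat by rewrite nat1r pnatr_eq0.
rewrite -ijk; elim: i j k ijk => [|i IHi] [|j] [|k] ijk //; try lia.
- by rewrite dyck_label0.
- rewrite dyck_labelS0 (IHi 1 k)%N; last lia.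
  have -> : i = (2 * k).+1 by lia.
  rewrite !add0n !add1n !factS !natrM.
  have := fN0 k; have := fN0 (2 * k)%N; have := sN0 k; have := sN0 k.+1.
  rewrite -!nat1r natrM => *.
  by field; do ?[apply/andP; split].
- rewrite dyck_labelSS (dyck_label_gt i j.+2) ?addn0; last lia.
  rewrite (IHi j 0)%N; last lia.
  have -> : i = j by lia.
  rewrite !addn0 fact0 !mul1r !factS !natrM.
  have := fN0 j; have := sN0 j; have := sN0 j.+1; rewrite -!nat1r => *.
  by field; do ?[apply/andP; split].
rewrite dyck_labelSS natrD (IHi j k.+1)%N; last lia.
rewrite (IHi j.+2 k)%N; last lia.
have -> : i = (j + k + k).+2 by lia.
rewrite !addSn !addnS !factS !natrM.
have := fN0 k; have := fN0 (j + k)%N; have := sN0 k; have := sN0 (j + k)%N.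
have := sN0 (j + k).+1; have := sN0 (j + k).+2.
rewrite -!nat1r !natrD => *.
by field; do ?[apply/andP; split].
Qed.

Theorem mainTheorem3 :
  [/\ forall n : nat, (dyck_poly 0 n)%:R = catalan n,
      forall n : nat, (1 <= n)%N -> (dyck_poly 1 n)%:R = catalan n
    & forall j n : nat, (1 < j)%N -> (j <= n)%N ->
        (dyck_poly j n)%:R =
        (dyck_poly (j - 1) n)%:R - (dyck_poly (j - 2) (n - 1))%:R :> rat].
Proof.
have p0 n : (dyck_poly 0 n)%:R = catalan n.
  by rewrite /dyck_poly subn0 (dyck_label_ballot n 0) add0n mul1r.
split=> // [n n_gt0 | [|[|j]] n // _ jn].
  rewrite -p0 /dyck_poly -dyck_labelS0; congr (dyck_label _ _)%:R; lia.
rewrite /dyck_poly !subSS !subn0.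
have -> : (2 * n - j.+1 = (2 * n - j.+2).+1)%N by lia.
have -> : (2 * (n - 1) - j = 2 * n - j.+2)%N by lia.
by rewrite dyck_labelSS natrD addrC addKr.
Qed.
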